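(* Let $K$ be an infinite field of characteristic $p>0$, let $n\ge r$ be positive integers, and let $\lambda=(a,2,1^d)\in\Lambda^+(n,r)$, where $d\ge3$ is an odd integer. Then none of the nonzero elements of $\mathrm{Hom}_S(\Delta(a,2,1^d),\Delta(a+d,2))$ is a composition of Carter–Payne homomorphisms.
   Context: $S=S_K(n,r)$ is the Schur algebra (modules over it are the homogeneous polynomial representations of $GL_n(K)$ of degree $r$), $\Lambda^+(n,r)$ is the set of partitions of $r$ with at most $n$ parts (padded by zeros), $1^d$ means $d$ parts equal to $1$, and $\Delta(\lambda)$ is the Weyl module of $GL_n(K)$ corresponding to the partition $\lambda$ (in the convention where $\Delta(\lambda)$ has highest weight $\lambda$). Carter–Payne homomorphisms: let $\alpha,\beta\in\Lambda^+(n,r)$ be such that $\beta$ is obtained from $\alpha$ by raising $e\ge1$ boxes from row $j$ to row $i$, where $i<j$, that is, $\beta_i=\alpha_i+e$, $\beta_j=\alpha_j-e$ and $\beta_q=\alpha_q$ for $q\ne i,j$; let $l_p(e)$ be the least integer $m$ with $p^m>e$, and suppose that $p^{l_p(e)}$ divides $\alpha_i-\alpha_j+j-i+e$. A nonzero homomorphism $\Delta(\alpha)\to\Delta(\beta)$ for such a pair is called a Carter–Payne homomorphism. *)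

(* Defs.v *)
From HB Require Import structures.
From mathcomp Require Import all_boot all_order all_fingroup all_algebra.

Set Implicit Arguments.
Unset Strict Implicit.
Unset Printing Implicit Defensive.

Import GRing.Theory.
Local Open Scope ring_scope.

(* Lambda^+(n, r): partitions of r with at most n parts, padded by zeros.     *)
Record Lambda_plus (n r : nat) := LambdaPlus {
  parts :> n.-tuple nat;
  _ : sorted geq parts && (sumn parts == r) }.

Definition pad (n : nat) (s : seq nat) : seq nat := s ++ nseq (n - size s)%N 0%N.

(* The tensor space E^{(x) r} for E = K^n: t i is the coefficient in t of     *)
(* e_(i 0) (x) ... (x) e_(i (r - 1)).                                         *)
Definition tens (K : fieldType) (n r : nat) : vectType K :=
  {ffun {ffun 'I_r -> 'I_n} -> K^o}.

Section PlacePermutations.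

Variables (K : fieldType) (n r : nat).

Definition place_fun (s : 'S_r) (t : tens K n r) : tens K n r :=
  [ffun i : {ffun 'I_r -> 'I_n} => t [ffun k => i (s k)]].

Fact place_fun_is_linear s : linear (place_fun s).
Proof. by move=> c t u; apply/ffunP=> i; rewrite !ffunE. Qed.

HB.instance Definition _ s :=
  GRing.isLinear.Build K (tens K n r) (tens K n r) _ (place_fun s)
    (place_fun_is_linear s).

Definition place (s : 'S_r) : 'End(tens K n r) := linfun (place_fun s).

End PlacePermutations.

(* The Schur algebra S_K(n, r) = End_{K S_r}(E^{(x) r}), the product being    *)
(* composition of endomorphisms.                                              *)
Section SchurAlgebra.

Variables (K : fieldType) (n r : nat).

Definition centralizes_places : {pred 'End(tens K n r)} :=
  fun x => [forall s, (x \o place K n s == place K n s \o x)%VF].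

Fact centralizes_places_zmod : zmod_closed centralizes_places.
Proof.
split=> [|x y /forallP cx /forallP cy]; apply/forallP=> s.
  by rewrite comp_lfun0l comp_lfun0r.
by rewrite comp_lfunDl comp_lfunDr comp_lfunNl comp_lfunNr
           (eqP (cx s)) (eqP (cy s)).
Qed.

HB.instance Definition _ :=
  GRing.isZmodClosed.Build _ centralizes_places centralizes_places_zmod.

Record Schur := SchurElt {
  schur_val :> 'End(tens K n r);
  schur_valP : schur_val \in centralizes_places }.

HB.instance Definition _ := [isSub for schur_val].
HB.instance Definition _ := [Choice of Schur by <:].
HB.instance Definition _ := [SubChoice_isSubZmodule of Schur by <:].

Fact schur_one_subproof : \1%VF \in centralizes_places.
Proof. by apply/forallP=> s; rewrite comp_lfun1l comp_lfun1r. Qed.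

Fact schur_mul_subproof (x y : Schur) : (x \o y)%VF \in centralizes_places.
Proof.
apply/forallP=> s; have /forallP cx := schur_valP x.
have /forallP cy := schur_valP y.
by rewrite -comp_lfunA (eqP (cy s)) !comp_lfunA (eqP (cx s)).
Qed.

Definition schur_one := SchurElt schur_one_subproof.
Definition schur_mul x y := SchurElt (schur_mul_subproof x y).

Fact schur_mulA : associative schur_mul.
Proof. by move=> x y z; apply: val_inj; rewrite /= comp_lfunA. Qed.
Fact schur_mul1l : left_id schur_one schur_mul.
Proof. by move=> x; apply: val_inj; rewrite /= comp_lfun1l. Qed.
Fact schur_mul1r : right_id schur_one schur_mul.
Proof. by move=> x; apply: val_inj; rewrite /= comp_lfun1r. Qed.
Fact schur_mulDl : left_distributive schur_mul +%R.
Proof. by move=> x y z; apply: val_inj; rewrite /= comp_lfunDl. Qed.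
Fact schur_mulDr : right_distributive schur_mul +%R.
Proof. by move=> x y z; apply: val_inj; rewrite /= comp_lfunDr. Qed.

HB.instance Definition _ := GRing.Zmodule_isPzRing.Build Schur
  schur_mulA schur_mul1l schur_mul1r schur_mulDl schur_mulDr.

End SchurAlgebra.

(* The Weyl module Delta(a), as the image of                                  *)
(*   D_(a_1) E (x) ... (x) D_(a_n) E --> E^{(x) r}                            *)
(*                               --> Lambda^(a'_1) E (x) Lambda^(a'_2) E ...  *)
(* where the boxes of the diagram of a are numbered row by row, D_k E is the  *)
(* space of symmetric tensors in E^{(x) k}, and Lambda^k E is embedded in     *)
(* E^{(x) k} by v_1 /\ ... /\ v_k |-> \sum_s sgn(s) v_(s 1) (x) ... (x) v_(s k). *)
Section WeylModule.

Variables (K : fieldType) (n r : nat) (a : Lambda_plus n r).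

Definition row_stab : {set 'S_r} :=
  [set s : 'S_r | [forall k, reshape_index a (s k) == reshape_index a k]].

Definition col_stab : {set 'S_r} :=
  [set s : 'S_r | [forall k, reshape_offset a (s k) == reshape_offset a k]].

Definition row_symmetric : {vspace tens K n r} :=
  (\bigcap_(s in row_stab) fixedSpace (place K n s))%VS.

Definition col_antisymmetrizer : 'End(tens K n r) :=
  \sum_(s in col_stab) (-1) ^+ s *: place K n s.

Definition weyl_space : {vspace tens K n r} :=
  (col_antisymmetrizer @: row_symmetric)%VS.

Definition Weyl : Type := subvs_of weyl_space.

HB.instance Definition _ := GRing.Zmodule.copy Weyl (subvs_of weyl_space).

Fact schur_placeE (x : Schur K n r) s t : x (place K n s t) = place K n s (x t).
Proof.
by have /forallP/(_ s)/eqP E := schur_valP x; rewrite -!comp_lfunE E.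
Qed.

Fact weyl_space_stable (x : Schur K n r) t :
  t \in weyl_space -> x t \in weyl_space.
Proof.
case/memv_imgP=> u u_sym ->.
have -> : x (col_antisymmetrizer u) = col_antisymmetrizer (x u).
  rewrite /col_antisymmetrizer !sum_lfunE linear_sum; apply: eq_bigr => s _.
  by rewrite !scale_lfunE linearZ /= schur_placeE.
apply: memv_img; rewrite memvE; apply/subv_bigcapP=> s s_row.
rewrite -memvE; apply/fixedSpaceP; rewrite -schur_placeE.
have /subv_bigcapP/(_ s s_row) : (<[u]> <= row_symmetric)%VS by rewrite -memvE.
by rewrite -memvE => /fixedSpaceP ->.
Qed.

(* By weyl_space_stable the projection is the identity here: the action of S  *)
(* on Delta(a) is the restriction of its action on E^{(x) r}.                 *)
Definition weyl_act (x : Schur K n r) (v : Weyl) : Weyl :=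
  vsproj weyl_space (x (vsval v)).

Fact weyl_actE x v : vsval (weyl_act x v) = x (vsval v).
Proof. by rewrite vsprojK // weyl_space_stable // subvsP. Qed.

Fact weyl_actA x y v : weyl_act x (weyl_act y v) = weyl_act (x * y) v.
Proof. by apply: val_inj; rewrite /= !weyl_actE /= comp_lfunE. Qed.
Fact weyl_act1 : left_id 1 weyl_act.
Proof. by move=> v; apply: val_inj; rewrite /= weyl_actE /= lfunE. Qed.
Fact weyl_actDr : right_distributive weyl_act +%R.
Proof.
move=> x u v; apply: val_inj; rewrite [LHS]weyl_actE.
transitivity (vsval (weyl_act x u) + vsval (weyl_act x v)); last by [].
by rewrite !weyl_actE -linearD.
Qed.
Fact weyl_actDl v : {morph weyl_act^~ v : x y / x + y}.
Proof.
move=> x y; apply: val_inj; rewrite [LHS]weyl_actE.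
transitivity (vsval (weyl_act x v) + vsval (weyl_act y v)); last by [].
by rewrite !weyl_actE -add_lfunE.
Qed.

HB.instance Definition _ := GRing.Zmodule_isLmodule.Build (Schur K n r) Weyl
  weyl_actA weyl_act1 weyl_actDr weyl_actDl.

End WeylModule.

Arguments Weyl K {n r} a.

(* b is obtained from a by raising e >= 1 boxes from row j to row i < j, and  *)
(* p ^ l_p(e) divides a_i - a_j + j - i + e, where l_p(e) = up_log p e.+1 is  *)
(* the least m with p ^ m > e; the truncated subtractions are exact since     *)
(* i < j and a is a partition.                                                *)
Definition carter_payne_pair (p n r : nat) (a b : Lambda_plus n r) : Prop :=
  exists (i j : 'I_n) (e : nat),
    [/\ (i < j)%N, (0 < e)%N,
        tnth b i = (tnth a i + e)%N /\ tnth a j = (tnth b j + e)%N,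
        forall q, q != i -> q != j -> tnth b q = tnth a q
      & (p ^ up_log p e.+1 %| (tnth a i - tnth a j) + (j - i) + e)%N].

Section CarterPayne.

Variables (K : fieldType) (p n r : nat).

(* {linear Weyl K a -> Weyl K b} is Hom_S(Delta(a), Delta(b)): both sides are *)
(* modules over Schur K n r.                                                  *)
Definition carter_payne (a b : Lambda_plus n r) (f : {linear Weyl K a -> Weyl K b}) :=
  carter_payne_pair p a b /\ (exists v, f v != 0).

Inductive carter_payne_composition (a b : Lambda_plus n r)
    (h : {linear Weyl K a -> Weyl K b}) : Prop :=
  | CPone of carter_payne h
  | CPcons (c : Lambda_plus n r) (f : {linear Weyl K a -> Weyl K c})
      (g : {linear Weyl K c -> Weyl K b}) of
      carter_payne f & carter_payne_composition g & h =1 g \o f.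

End CarterPayne.

(* Main.v *)
(* A homomorphism out of Delta(lambda) is determined by the image of the      *)
(* highest weight vector, and that image is killed by all raising operators.  *)
(* For mu = (a + d, 2), the vectors of weight lambda in Delta(mu) amount to   *)
(* symmetric functions psi(x, y) of the two entries of the second row, with   *)
(* psi = 0 as soon as an entry is the first letter.  For lambda = (a, 2, 1^d) *)
(* the raising operators then force psi to vanish unless K has characteristic *)
(* 2 and a is even.  In that case, if d is odd, the parity condition on       *)
(* Carter-Payne pairs leaves only two ways out of lambda: (a + 1, 2, 1^(d-1)),*)
(* which has no nonzero homomorphism to Delta(mu) since a + 1 is odd, and     *)
(* (a + 1, 1^(d+1)), whose only Carter-Payne successor is again               *)
(* (a + 1, 2, 1^(d-1)).                                                       *)

Require Import Defs.
From HB Require Import structures.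
From mathcomp Require Import all_boot all_order all_fingroup all_algebra.
From mathcomp Require Import zify ring.

Set Implicit Arguments.
Unset Strict Implicit.
Unset Printing Implicit Defensive.

Import GRing.Theory.
Local Open Scope ring_scope.

(** The generator [weyl_gen] of Delta(lambda) is killed by raising operators ([weyl_gen_generates],
    [raise_weyl_gen]), so a nonzero homomorphism is a nonzero array of coefficients subject to
    linear relations ([weyl_hom_coefficients]). For a target (m, 2) the array comes from a symmetric
    psi ([two_row_coefficients]). Number rows from 0 and take lambda = (a, 2, 1^d). Let A = psi(1,
    1), B_l = psi(1, l) and C_kl = psi(k, l) for distinct rows k, l of length one. The relations
    read A = -2 B_l, C_kl = -2 B_l, a B_l = A and, for d >= 3, 2 B_l = 0. If all B_l vanish, so does
    the array; hence some B_l is nonzero, and 2 = a = 0 in K ([hom_near_hook_two_row]). So p = 2 and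
    a is even. By parity ([carter_payne_pair_near_hook], [carter_payne_pair_hook]) no Carter-Payne
    chain reaches mu without passing through (a + 1, 2, 1^(d-1)), and there the same lemma would
    require a + 1 to be even. *)

(** * Words, place permutations and explicit elements of the Schur algebra *)

Section Words.

Variables (K : fieldType) (n r : nat).

Local Notation word := {ffun 'I_r -> 'I_n}.

Definition word_perm (i : word) (s : 'S_r) : word := [ffun k => i (s k)].

Lemma word_permE i s k : word_perm i s k = i (s k).
Proof. by rewrite ffunE. Qed.

Lemma word_permM i s t : word_perm i (s * t)%g = word_perm (word_perm i t) s.
Proof. by apply/ffunP=> k; rewrite !ffunE permM. Qed.

Lemma word_perm1 i : word_perm i 1%g = i.
Proof. by apply/ffunP=> k; rewrite !ffunE perm1. Qed.

Lemma word_perm_inj s : injective (word_perm^~ s).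
Proof.
by move=> i j /(congr1 (word_perm^~ s^-1%g)); rewrite -!word_permM mulVg !word_perm1.
Qed.

Lemma placeE s (t : tens K n r) i : place K n s t i = t (word_perm i s).
Proof. by rewrite lfunE ffunE. Qed.

Lemma Schur_of_fun (F : tens K n r -> tens K n r) :
    linear F ->
    (forall s t i, F (place K n s t) i = F t (word_perm i s)) ->
  exists x : Defs.Schur K n r, forall t, x t = F t.
Proof.
move=> linF FE.
pose m := GRing.isLinear.Build K (tens K n r) (tens K n r) *:%R F linF.
pose F' : {linear tens K n r -> tens K n r} := HB.pack F m.
have F'E t : linfun F' t = F t by rewrite lfunE.
have cF : linfun F' \in @centralizes_places K n r.
  apply/forallP=> s; apply/eqP/lfunP=> t; apply/ffunP=> i.
  by rewrite !comp_lfunE placeE !F'E FE.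
by exists (SchurElt cF) => t; rewrite /= F'E.
Qed.

Definition basis_word (j : word) : tens K n r := [ffun i => (i == j)%:R].

Lemma basis_wordE j i : basis_word j i = (i == j)%:R.
Proof. by rewrite ffunE. Qed.

Definition set_letter (i : word) P (x : 'I_n) : word :=
  [ffun k => if k == P then x else i k].

(** The matrix unit sending e_k to e_j, acting as a derivation on tensors. On coefficients the
    direction is reversed: a letter j of the word is turned back into k. *)
Definition raise_fun (j k : 'I_n) (t : tens K n r) : tens K n r :=
  [ffun i : word => \sum_(P | i P == j) t (set_letter i P k)].

Lemma Schur_raise j k :
  exists x : Defs.Schur K n r, forall t, x t = raise_fun j k t.
Proof.
apply: Schur_of_fun => [c t u | s t i].
  apply/ffunP=> i; rewrite !ffunE /= scaler_sumr -big_split /=.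
  by apply: eq_bigr => P _; rewrite !ffunE.
rewrite !ffunE (reindex_inj (@perm_inj _ s)) /=.
apply: eq_big => [P|P _]; first by rewrite !ffunE.
rewrite placeE; congr (t _); apply/ffunP=> Q.
by rewrite !ffunE (inj_eq perm_inj).
Qed.

Lemma set_letterE i P x k : set_letter i P x k = if k == P then x else i k.
Proof. by rewrite ffunE. Qed.

Lemma set_letter_id i P : set_letter i P (i P) = i.
Proof. by apply/ffunP=> k; rewrite ffunE; case: eqP => [->|]. Qed.

(** Two places that trade letters undergo a transposition; this turns raising operators into sums of
    place permutations. *)
Lemma set_letterC (i : word) P Q x :
  i Q = x -> set_letter (set_letter i P x) Q (i P) = word_perm i (tperm P Q).
Proof.
move=> iQ; apply/ffunP=> k; rewrite !ffunE.
case: tpermP => [->|->|/eqP/negPf-> /eqP/negPf-> //]; last by rewrite eqxx.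
by rewrite eqxx iQ; case: eqP => [->|].
Qed.

(** An orbit of words consists of all words of one weight, so this is the projection onto a weight
    space. *)
Lemma Schur_proj_orbit i0 : exists x : Defs.Schur K n r, forall t i,
  x t i = if [exists s, i == word_perm i0 s] then t i else 0.
Proof.
pose F (t : tens K n r) : tens K n r :=
  [ffun i => if [exists s, i == word_perm i0 s] then t i else 0].
case: (@Schur_of_fun F) => [c t u|s t i|x xE].
- by apply/ffunP=> i; rewrite !ffunE; case: ifP => // _; rewrite scaler0 addr0.
- rewrite !ffunE placeE; congr (if _ then _ else _).
  apply/existsP/existsP=> [] [t0 /eqP Ei].
    by exists (s * t0)%g; rewrite word_permM -Ei.
  by exists (s^-1 * t0)%g; rewrite word_permM -Ei -word_permM mulVg word_perm1.
by exists x => t i; rewrite xE ffunE.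
Qed.

(* The endomorphism sending e_(i0) to [u] and vanishing off the orbit of i0.  *)
Lemma Schur_basis_word i0 (u : tens K n r) :
    (forall s, word_perm i0 s = i0 -> place K n s u = u) ->
  exists x : Defs.Schur K n r, x (basis_word i0) = u.
Proof.
move=> u_fix.
(* The matrix of the endomorphism. The chosen s is immaterial because [u] is fixed by the stabilizer
   of [i0]. *)
pose M (i j : word) : K := if [pick s | j == word_perm i0 s] is Some s
  then u (word_perm i s^-1%g) else 0.
have ME i s : M i (word_perm i0 s) = u (word_perm i s^-1%g).
  rewrite /M; case: pickP => [t /eqP E|/(_ s)/eqP//].
  have /u_fix u_st: word_perm i0 (s^-1 * t)%g = i0.
    by rewrite word_permM -E -word_permM mulVg word_perm1.
  by rewrite -[in LHS]u_st placeE -word_permM mulgK.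
have M0 i j : (forall s, j != word_perm i0 s) -> M i j = 0.
  by rewrite /M => j_off; case: pickP => // s; rewrite (negPf (j_off s)).
have M_perm i j s : M (word_perm i s) (word_perm j s) = M i j.
  have [[t /eqP->]|j_off] :=
    altP (@existsP _ (fun t : 'S_r => j == word_perm i0 t)).
    by rewrite -word_permM !ME -word_permM invMg mulgKV.
  rewrite negb_exists in j_off; move/forallP: j_off => j_off.
  rewrite !M0 // => t.
  apply: contraNneq (j_off (s^-1 * t)%g) => E; apply/eqP.
  by rewrite word_permM -E -word_permM mulVg word_perm1.
pose F (t : tens K n r) : tens K n r := [ffun i => \sum_j M i j * t j].
case: (@Schur_of_fun F) => [c t v|s t i|x xE].
- apply/ffunP=> i; rewrite !ffunE /= scaler_sumr -big_split /=.
  by apply: eq_bigr => j _; rewrite !ffunE mulrDr mulrCA.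
- rewrite !ffunE [RHS](reindex_inj (@word_perm_inj s)) /=.
  by apply: eq_bigr => j _; rewrite M_perm placeE.
exists x; rewrite xE; apply/ffunP=> i.
rewrite ffunE (bigD1 i0) //= big1 => [|j /negPf j_i0].
  by rewrite !ffunE eqxx mulr1 addr0 -{1}(word_perm1 i0) ME invg1 word_perm1.
by rewrite !ffunE j_i0 mulr0.
Qed.

End Words.

(** * The highest weight vector of a Weyl module *)

Section HighestWeight.

Variables (K : fieldType) (n r : nat) (a : Lambda_plus n r).

Local Notation word := {ffun 'I_r -> 'I_n}.

Lemma Lambda_plus_sum : sumn a = r.
Proof. by case: a => c /= /andP[_ /eqP]. Qed.

Lemma Lambda_plus_nth_geq i j : (i <= j)%N -> (nth 0%N a j <= nth 0%N a i)%N.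
Proof.
case: a => c /= /andP[c_sorted _] le_ij.
have [lt_j|le_j] := ltnP j (size c); last by rewrite nth_default.
have geq_trans : transitive geq by move=> x y z /= yx zy; apply: leq_trans zy yx.
apply: (sorted_leq_nth geq_trans _ 0%N c_sorted) => //; first exact: leqnn.
by rewrite inE (leq_ltn_trans le_ij).
Qed.

Fact row_word_subproof (k : 'I_r) : (reshape_index a k < n)%N.
Proof.
by rewrite -[X in (_ < X)%N](size_tuple a) reshape_indexP // Lambda_plus_sum.
Qed.

Definition row_word : word := [ffun k => Ordinal (row_word_subproof k)].

Lemma row_wordE k : row_word k = reshape_index a k :> nat.
Proof. by rewrite ffunE. Qed.

Lemma row_word_stab s : (word_perm row_word s == row_word) = (s \in row_stab a).
Proof.
rewrite inE; apply/eqP/forallP=> [/ffunP E k|E].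
  by have /(congr1 val) := E k; rewrite !ffunE /= => ->.
by apply/ffunP=> k; apply: val_inj; rewrite !ffunE /=; apply/eqP.
Qed.

Lemma row_symmetricP (u : tens K n r) :
  reflect (forall s, s \in row_stab a -> place K n s u = u)
          (u \in row_symmetric K a).
Proof.
rewrite memvE; apply: (iffP subv_bigcapP) => E s /E.
  by rewrite -memvE => /fixedSpaceP.
by move=> us; rewrite -memvE; apply/fixedSpaceP.
Qed.

Lemma col_antisymmetrizerE (u : tens K n r) i :
  col_antisymmetrizer K a u i =
  \sum_(s in col_stab a) (-1) ^+ s * u (word_perm i s).
Proof.
rewrite sum_lfunE sum_ffunE; apply: eq_bigr => s _.
by rewrite scale_lfunE ffunE placeE.
Qed.

Lemma Schur_col_antisymmetrizer (x : Defs.Schur K n r) u :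
  x (col_antisymmetrizer K a u) = col_antisymmetrizer K a (x u).
Proof.
rewrite /col_antisymmetrizer !sum_lfunE linear_sum; apply: eq_bigr => s _.
by rewrite !scale_lfunE linearZ /= schur_placeE.
Qed.

(** Multiplication by the transposition of P and Q is a sign-reversing involution of the column
    stabilizer, so the terms cancel in pairs. *)
Lemma col_antisymmetrizer_alternate (u : tens K n r) (P Q : 'I_r) :
    P != Q -> reshape_offset a P = reshape_offset a Q ->
    place K n (tperm P Q) u = u ->
  col_antisymmetrizer K a u = 0.
Proof.
move=> PQ colPQ uPQ; apply/ffunP=> i; rewrite col_antisymmetrizerE ffunE.
pose t := tperm P Q.
have oddMt s : (t * s)%g = ~~ s :> bool by rewrite odd_permM odd_tperm PQ.
have colM s : (t * s \in col_stab a)%g = (s \in col_stab a).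
  have col_t k : reshape_offset a (t k) = reshape_offset a k.
    by rewrite /t; case: tpermP => // ->.
  rewrite !inE; apply/forallP/forallP=> E k; have := E (t k).
    by rewrite permM tpermK col_t.
  by rewrite permM col_t.
rewrite (bigID (fun s : 'S_r => s : bool)) /=.
apply: canLR (subrK _) _; rewrite add0r -sumrN.
rewrite (reindex_inj (mulgI t)); apply: eq_big => /= s.
  by rewrite oddMt colM.
rewrite oddMt => /andP[_ /negPf->]; rewrite mulN1r mul1r; congr (- _).
by rewrite word_permM -placeE uPQ.
Qed.

Lemma row_symmetric_basis_word : basis_word K row_word \in row_symmetric K a.
Proof.
apply/row_symmetricP=> s; rewrite -row_word_stab => /eqP s_st.
apply/ffunP=> i; rewrite placeE !basis_wordE -[in LHS]s_st.
by rewrite (inj_eq (@word_perm_inj _ _ s)).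
Qed.

Definition weyl_gen : Weyl K a :=
  vsproj (weyl_space K a) (col_antisymmetrizer K a (basis_word K row_word)).

Lemma weyl_genE :
  vsval weyl_gen = col_antisymmetrizer K a (basis_word K row_word).
Proof. by rewrite vsprojK // memv_img // row_symmetric_basis_word. Qed.

(** The stabilizer of [row_word] is the row stabilizer, so every row-symmetric tensor is the image
    of its basis word under S, and S commutes with the antisymmetrizer. *)
Lemma weyl_gen_generates (v : Weyl K a) :
  exists x : Defs.Schur K n r, v = x *: weyl_gen.
Proof.
have /memv_imgP[u /row_symmetricP u_sym vE] := subvsP v.
have [s|x xE] := @Schur_basis_word K n r row_word u.
  by move/eqP; rewrite row_word_stab => /u_sym.
exists x; apply: val_inj; rewrite [RHS]weyl_actE weyl_genE.
by rewrite Schur_col_antisymmetrizer xE.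
Qed.

Lemma raise_basis_word (j k : 'I_n) :
  raise_fun j k (basis_word K row_word) =
  \sum_(Q | row_word Q == k) basis_word K (set_letter row_word Q j).
Proof.
apply/ffunP=> i; rewrite sum_ffunE ffunE big_mkcond [RHS]big_mkcond.
apply: eq_bigr => P _; rewrite !basis_wordE.
have [iP|iP] := eqVneq (i P) j; have [LP|LP] := eqVneq (row_word P) k.
- suff -> : (set_letter i P k == row_word) = (i == set_letter row_word P j) by [].
  apply/eqP/eqP=> [E|->].
    by rewrite -E -{1}(set_letter_id i P) iP; apply/ffunP=> Q; rewrite !ffunE; case: eqP.
  by apply/ffunP=> Q; rewrite -LP !ffunE; case: eqP => [->|]; rewrite ?ffunE.
- by case: eqP => // E; rewrite -E ffunE eqxx eqxx in LP.
- by case: eqP => // E; rewrite E ffunE eqxx eqxx in iP.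
- by [].
Qed.

(** After raising, the changed box Q and the box Q' of row j in the same column carry the same
    letter, so antisymmetrizing gives 0. *)
Lemma raise_weyl_gen (x : Defs.Schur K n r) (j k : 'I_n) :
  (j < k)%N -> (forall t, x t = raise_fun j k t) -> x *: weyl_gen = 0.
Proof.
move=> ltjk xE; apply: val_inj; rewrite [LHS]weyl_actE weyl_genE.
rewrite Schur_col_antisymmetrizer xE raise_basis_word linear_sum.
rewrite [RHS]linear0 big1 // => Q /eqP LQ.
pose c := reshape_offset a Q.
(* Row j is at least as long as row k, so it meets the column of Q. *)
have lt_c : (c < nth 0%N a j)%N.
  apply: leq_trans (Lambda_plus_nth_geq (ltnW ltjk)).
  have -> : nth 0%N a k = nth 0%N a (reshape_index a Q) by rewrite -LQ row_wordE.
  by apply: reshape_offsetP; rewrite Lambda_plus_sum.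
have lt_r : (flatten_index a j c < r)%N.
  by rewrite -[X in (_ < X)%N]Lambda_plus_sum flatten_indexP.
pose Q' := Ordinal lt_r.
have LQ' : row_word Q' = j.
  by apply: val_inj; rewrite /= row_wordE flatten_indexKl.
have neqQ : Q != Q'.
  by apply: contraTneq ltjk => EQ; rewrite -LQ EQ LQ' ltnn.
apply: (col_antisymmetrizer_alternate neqQ).
  by rewrite /= flatten_indexKr.
apply/ffunP=> i; rewrite placeE !basis_wordE.
rewrite -[in LHS](inj_eq (@word_perm_inj _ _ (tperm Q Q'))).
rewrite -word_permM tperm2 word_perm1; congr (_ == _)%:R.
apply/ffunP=> R; rewrite word_permE !set_letterE.
case: tpermP => [->|->|//]; first by rewrite eqxx LQ' if_same.
by rewrite eqxx LQ' if_same.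
Qed.

End HighestWeight.

(** * Homomorphisms as solutions of linear relations *)

Section Homomorphisms.

Variables (K : fieldType) (n r : nat).

(* The image of the generator is again killed by the raising operators;       *)
(* reading this on the orbit of the word of [a] turns each raising operator   *)
(* into a sum over the boxes Q that a box Q0 of a lower row is exchanged with. *)
Lemma weyl_hom_coefficients (a b : Lambda_plus n r)
    (f : {linear Weyl K a -> Weyl K b}) :
    (exists v, f v != 0) ->
  exists2 u, u \in row_symmetric K b &
    let w s := col_antisymmetrizer K b u (word_perm (row_word a) s) in
    (exists s, w s != 0) /\
    (forall s Q0 (j : 'I_n), (j < row_word a Q0)%N ->
      w s + \sum_(Q | row_word a Q == j) w (s * tperm Q0 Q)%g = 0).
Proof.
case=> v fv; set L := row_word a.
have f_gen : f (weyl_gen K a) != 0.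
  have [x vE] := weyl_gen_generates v.
  by apply: contraNneq fv; rewrite vE linearZ /= => ->; rewrite scaler0.
have /memv_imgP[u u_sym wE] := subvsP (f (weyl_gen K a)).
exists u => //=; rewrite -wE; set w := vsval _ in wE *.
split.
  (* The projection onto the weight of [L] fixes the generator, hence its image, which is therefore
     supported on rearrangements of [L]. *)
  apply/existsP; apply: contraNT f_gen; rewrite negb_exists => /forallP w0.
  have [x xE] := Schur_proj_orbit K L.
  have x_gen : x *: weyl_gen K a = weyl_gen K a.
    apply: val_inj; rewrite [LHS]weyl_actE [RHS]weyl_genE weyl_genE Schur_col_antisymmetrizer.
    congr (col_antisymmetrizer K a _); apply/ffunP=> i; rewrite xE basis_wordE.
    case: ifP => // /existsP; case: eqP => // -> [].
    by exists 1%g; rewrite word_perm1.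
  rewrite -x_gen linearZ /=; apply/eqP/val_inj; rewrite [LHS]weyl_actE.
  apply/ffunP=> i; rewrite xE [RHS]ffunE; case: existsP => // -[s /eqP->].
  by apply/eqP; have := w0 s; rewrite negbK.
move=> s Q0 j ltj.
have [x xE] := Schur_raise K r j (L Q0).
have : x *: f (weyl_gen K a) = 0.
  by rewrite -linearZ /= (raise_weyl_gen _ ltj xE) linear0.
move/(congr1 val); rewrite [LHS]weyl_actE xE.
(* The vanishing is read at the word with letter j at P0: the term at P0 restores the original word,
   every other term is an exchange. *)
pose P0 := (s^-1)%g Q0; have sP0 : s P0 = Q0 by rewrite permKV.
move/ffunP/(_ (set_letter (word_perm L s) P0 j)).
rewrite [RHS]ffunE ffunE (bigD1 P0) /=; last by rewrite set_letterE eqxx.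
have -> : set_letter (set_letter (word_perm L s) P0 j) P0 (L Q0) = word_perm L s.
  by apply/ffunP=> P; rewrite !set_letterE word_permE; case: eqP => // ->; rewrite sP0.
rewrite -/w => {2}<-; congr (_ + _).
rewrite (reindex_inj (@perm_inj _ s)) /=.
apply: eq_big => [P|P /eqP LP].
  rewrite set_letterE word_permE; have [->|//] := eqVneq P P0; rewrite ?andbT //.
  by rewrite sP0 andbF; apply: contraTF ltj => /eqP <-; rewrite ltnn.
have iP : word_perm L s P = j by rewrite word_permE.
rewrite -sP0 -[L (s P0)](word_permE L s P0) set_letterC // -word_permM.
by rewrite -tpermJ conjgE mulKVg.
Qed.

End Homomorphisms.

Lemma perm_extension (T : finType) (s t : seq T) :
  size s = size t -> uniq s -> uniq t -> exists g : {perm T}, map g s = t.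
Proof.
elim: s t => [|x s IHs] [|y t] //=; first by exists 1%g.
case=> /IHs{}IHs /andP[xs /IHs{}IHs] /andP[yt /IHs[g gs]].
exists (g * tperm (g x) y)%g; rewrite permM tpermL; congr (_ :: _).
rewrite -gs; apply/eq_in_map=> z zs; rewrite permM tpermD //.
  by rewrite (inj_eq perm_inj); apply: contraNneq xs => ->.
by apply: contraNneq yt => ->; rewrite -gs map_f.
Qed.

(** * Coefficients in the Weyl module of a two-row partition (m, 2) *)

Section TwoRows.

Variables (K : fieldType) (n r m : nat) (b : Lambda_plus n r).
Hypotheses (m_gt1 : (1 < m)%N) (bE : b = pad n [:: m; 2]%N :> seq nat).

Local Notation word := {ffun 'I_r -> 'I_n}.

Lemma two_row_sum : r = (m + 2)%N.
Proof. by rewrite -(Lambda_plus_sum b) bE /pad /= sumn_nseq; lia. Qed.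

Lemma two_row_box (k : 'I_r) :
  reshape_index b k = (m <= k)%N /\
  reshape_offset b k = (if k < m then k : nat else k - m)%N.
Proof.
have ltk := ltn_ord k; have rE := two_row_sum.
have b0 : nth 0%N b 0 = m by rewrite bE.
have b1 : nth 0%N b 1 = 2%N by rewrite bE.
have [ltkm|lemk] := ltnP k m.
  have kE : nat_of_ord k = flatten_index b 0 k by rewrite /flatten_index take0.
  by split; rewrite {1}kE ?flatten_indexKl ?flatten_indexKr ?b0.
have kE : nat_of_ord k = flatten_index b 1 (k - m).
  by rewrite /flatten_index bE /=; lia.
by split; rewrite {1}kE ?flatten_indexKl ?flatten_indexKr ?b1 //; lia.
Qed.

Variables p0 p1 p2 p3 : 'I_r.
Hypotheses (p0E : p0 = 0%N :> nat) (p1E : p1 = 1%N :> nat).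
Hypotheses (p2E : p2 = m :> nat) (p3E : p3 = m.+1 :> nat).

Lemma two_row_corners : uniq [:: p0; p1; p2; p3].
Proof. by rewrite /= !inE -!val_eqE /=; lia. Qed.

Lemma two_row_row_stab (s : 'S_r) : s p2 = p2 -> s p3 = p3 -> s \in row_stab b.
Proof.
move=> s2 s3; rewrite inE; apply/forallP=> k.
have [[-> _] [-> _]] := (two_row_box (s k), two_row_box k).
have lt k' : (k' : 'I_r) != p2 -> k' != p3 -> (m <= k')%N = false.
  by have := ltn_ord k'; rewrite -!val_eqE /= {2}two_row_sum; lia.
have [->|k2] := eqVneq k p2; first by rewrite s2.
have [->|k3] := eqVneq k p3; first by rewrite s3.
by rewrite !lt // -1?s2 -1?s3 (inj_eq perm_inj).
Qed.

Lemma two_row_row_tperm : tperm p2 p3 \in row_stab b.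
Proof.
rewrite inE; apply/forallP=> k.
have [[-> _] [-> _]] := (two_row_box (tperm p2 p3 k), two_row_box k).
by case: tpermP => [->|->|//]; rewrite p2E p3E leqnn leqnSn.
Qed.

(** Only the first two columns have two boxes, so the group is a Klein four-group. *)
Lemma two_row_col_stab :
  col_stab b =i [:: 1; tperm p0 p2; tperm p1 p3; tperm p0 p2 * tperm p1 p3]%g.
Proof.
have rE := two_row_sum.
have colP (s : 'S_r) : reflect (forall k : 'I_r,
    (if s k < m then s k : nat else s k - m)%N = (if k < m then k : nat else k - m)%N)
    (s \in col_stab b).
  rewrite inE; apply: (iffP forallP) => E k; have := E k;
  have [[_ ->] [_ ->]] := (two_row_box (s k), two_row_box k).
    by move/eqP.
  by move->.
have colM (s t : 'S_r) : s \in col_stab b -> t \in col_stab b ->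
    (s * t)%g \in col_stab b.
  by move=> /colP sc /colP tc; apply/colP=> k; rewrite permM tc.
have t02 : tperm p0 p2 \in col_stab b.
  by apply/colP=> k; case: tpermP => [->|->|//] /=; case: ifP; case: ifP; lia.
have t13 : tperm p1 p3 \in col_stab b.
  by apply/colP=> k; case: tpermP => [->|->|//] /=; case: ifP; case: ifP; lia.
(* The images of p0 and p1 determine a column-preserving permutation; the other three cases reduce
   to this one by multiplication. *)
have fixE (s : 'S_r) : s \in col_stab b -> s p0 = p0 -> s p1 = p1 -> s = 1%g.
  move=> /colP sc s0 s1; apply/permP=> k; rewrite perm1; apply: val_inj => /=.
  have E0 : (s k == p0) = (k == p0) by rewrite -{1}s0 (inj_eq perm_inj).
  have E1 : (s k == p1) = (k == p1) by rewrite -{1}s1 (inj_eq perm_inj).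
  have := sc k; move: E0 E1; rewrite -!val_eqE /=.
  have := ltn_ord k; have := ltn_ord (s k).
  by case: ifP; case: ifP; lia.
have invE (s t : 'S_r) : (s * t = 1)%g -> s = (t^-1)%g.
  by move=> st; apply: (mulIg t); rewrite st mulVg.
move=> s; apply/idP/idP; last first.
  move=> s_in; move: (s_in); rewrite 4!inE => /or4P[] /eqP->; rewrite ?colM //.
  by apply/colP=> k; rewrite perm1.
move=> s_col; have /colP sc := s_col.
have s0 : s p0 = p0 \/ s p0 = p2.
  have lt_r := ltn_ord (s p0); have := sc p0; rewrite p0E (ltnW m_gt1).
  case: ltnP => ltm off; [left|right]; apply: val_inj; rewrite /=; lia.
have s1 : s p1 = p1 \/ s p1 = p3.
  have lt_r := ltn_ord (s p1); have := sc p1; rewrite p1E m_gt1.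
  case: ltnP => ltm off; [left|right]; apply: val_inj; rewrite /=; lia.
have d01 : p0 != p1 by rewrite -val_eqE /=; lia.
have d03 : p0 != p3 by rewrite -val_eqE /=; lia.
have d21 : p2 != p1 by rewrite -val_eqE /=; lia.
have d23 : p2 != p3 by rewrite -val_eqE /=; lia.
have d10 : p1 != p0 by rewrite -val_eqE /=; lia.
have d30 : p3 != p0 by rewrite -val_eqE /=; lia.
have d12 : p1 != p2 by rewrite eq_sym.
have d32 : p3 != p2 by rewrite eq_sym.
rewrite !inE; case: s0 s1 => s0 [] s1.
- by rewrite (fixE s) ?eqxx.
- rewrite [s](invE _ (tperm p1 p3)) ?tpermV ?eqxx ?orbT //.
  by apply: fixE; rewrite ?colM // permM ?s0 ?s1 ?tpermR // tpermD.
- rewrite [s](invE _ (tperm p0 p2)) ?tpermV ?eqxx ?orbT //.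
  by apply: fixE; rewrite ?colM // permM ?s0 ?s1 ?tpermR // tpermD.
- rewrite [s](invE _ (tperm p1 p3 * tperm p0 p2)%g).
    by rewrite invMg !tpermV eqxx !orbT.
  apply: fixE; rewrite ?colM // !permM ?s0 ?s1 ?tpermR.
    by rewrite (@tpermD _ p1 p3) // tpermR.
  by rewrite (@tpermD _ p0 p2).
Qed.

Lemma two_row_col_antisymmetrizerE (u : tens K n r) i :
  col_antisymmetrizer K b u i =
  u i - u (word_perm i (tperm p0 p2)) - u (word_perm i (tperm p1 p3)) +
  u (word_perm i (tperm p0 p2 * tperm p1 p3)%g).
Proof.
have [d02 d13] : p0 != p2 /\ p1 != p3 by rewrite -!val_eqE /=; lia.
have E1 : tperm p0 p2 p1 = p1 by apply: tpermD; rewrite -val_eqE /=; lia.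
have E0 : tperm p1 p3 p0 = p0 by apply: tpermD; rewrite -val_eqE /=; lia.
have E2 : tperm p1 p3 p2 = p2 by apply: tpermD; rewrite -val_eqE /=; lia.
have uS : uniq [:: 1; tperm p0 p2; tperm p1 p3; tperm p0 p2 * tperm p1 p3]%g.
  apply: (@map_uniq _ _ (fun s : 'S_r => (s p0, s p1))).
  rewrite /= !inE !xpair_eqE !permM !perm1 !tpermL E1 E0 E2 tpermL.
  by rewrite ?(eq_sym p2 p0) ?(eq_sym p3 p1) !eqxx (negPf d02) (negPf d13).
rewrite col_antisymmetrizerE (eq_bigl _ _ two_row_col_stab) -big_uniq //.
rewrite !big_cons big_nil !odd_permM !odd_tperm d02 d13 odd_perm1 /=.
rewrite word_perm1 !expr0 !expr1 !mulN1r !mul1r addrA.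
by rewrite [X in _ + (_ + X)]addr0 addrA.
Qed.

Lemma two_row_coefficients (u : tens K n r) (L : word) (z : 'I_n) :
    u \in row_symmetric K b ->
  exists psi : 'I_n -> 'I_n -> K,
    [/\ forall x y, psi x y = psi y x, forall y, psi z y = 0
      & forall s, col_antisymmetrizer K b u (word_perm L s) =
          psi (L (s p2)) (L (s p3)) - psi (L (s p0)) (L (s p3))
          - psi (L (s p2)) (L (s p1)) + psi (L (s p0)) (L (s p1))].
Proof.
move=> /row_symmetricP u_sym.
have d23 : p2 != p3 by rewrite -val_eqE /=; lia.
(* [u] takes the same value on two rearrangements of L with the same second   *)
(* row: these differ by a permutation of the first row.                       *)
have uE (s t : 'S_r) : L (s p2) = L (t p2) -> L (s p3) = L (t p3) ->
    u (word_perm L s) = u (word_perm L t).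
  move=> L2 L3.
  pose g1 := tperm (s p2) (t p2); pose g2 := tperm (g1 (s p3)) (t p3).
  have Lt (P Q R : 'I_r) : L P = L Q -> L (tperm P Q R) = L R.
    by case: tpermP => // ->.
  have Lg1 P : L (g1 P) = L P by apply: Lt.
  have Lg2 P : L (g2 P) = L P by apply: Lt; rewrite Lg1.
  pose h := (s * g1 * g2 * t^-1)%g.
  have hE : word_perm L s = word_perm (word_perm L t) h.
    by apply/ffunP=> P; rewrite !word_permE !permM permKV Lg2 Lg1.
  rewrite hE -placeE u_sym //; apply: two_row_row_stab; rewrite !permM.
    have g1s : g1 (s p2) = t p2 by rewrite tpermL.
    rewrite g1s tpermD ?permK //; last by rewrite (inj_eq perm_inj) eq_sym.
    by rewrite -g1s (inj_eq perm_inj) (inj_eq perm_inj) eq_sym.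
  by rewrite tpermL permK.
pose phi x y := if [pick s : 'S_r | (L (s p2) == x) && (L (s p3) == y)] is Some s
  then u (word_perm L s) else 0.
have phiE s : u (word_perm L s) = phi (L (s p2)) (L (s p3)).
  rewrite /phi; case: pickP => [t /andP[/eqP t2 /eqP t3]|/(_ s)].
    exact: uE.
  by rewrite !eqxx.
have phiC x y : phi x y = phi y x.
  rewrite {1}/phi; case: pickP => [s /andP[/eqP <- /eqP <-]|none].
    rewrite -(u_sym _ two_row_row_tperm) placeE -word_permM phiE.
    by rewrite !permM tpermL tpermR.
  rewrite /phi; case: pickP => // s /andP[s2 s3]; case/negP: (none (tperm p2 p3 * s)%g).
  by rewrite !permM tpermL tpermR s2 s3.
(* The alternating sum kills functions of x alone or of y alone, so [phi] can be normalized to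
   vanish at [z]. *)
exists (fun x y => phi x y - phi z y - phi x z + phi z z); split=> [x y|y|s].
- by rewrite (phiC x y) (phiC z y) (phiC x z); ring.
- by ring.
rewrite two_row_col_antisymmetrizerE -!word_permM !phiE !permM.
have -> : tperm p0 p2 p2 = p0 by rewrite tpermR.
have -> : tperm p0 p2 p3 = p3 by apply: tpermD; rewrite -val_eqE /=; lia.
have -> : tperm p1 p3 p3 = p1 by rewrite tpermR.
have -> : tperm p1 p3 p2 = p2 by apply: tpermD; rewrite -val_eqE /=; lia.
have -> : tperm p1 p3 p0 = p0 by apply: tpermD; rewrite -val_eqE /=; lia.
by ring.
Qed.

End TwoRows.

(** * Homomorphisms from (a, 2, 1^d) to (a + d, 2) *)

Section NearHook.

Variables (K : fieldType) (n r a d : nat) (lambda mu : Lambda_plus n r).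
Hypotheses (lambdaE : lambda = pad n [:: a, 2 & nseq d 1]%N :> seq nat)
           (muE : mu = pad n [:: a + d; 2]%N :> seq nat).

Lemma near_hook_a_gt1 : (1 < a)%N.
Proof. by have := Lambda_plus_nth_geq lambda (leqnSn 0); rewrite lambdaE. Qed.

Lemma near_hook_sum : r = (a + d + 2)%N.
Proof.
rewrite -(Lambda_plus_sum lambda) lambdaE /pad /= sumn_cat !sumn_nseq; lia.
Qed.

Lemma near_hook_row (k : 'I_r) : reshape_index lambda k =
  (if k < a then 0 else if k < a.+2 then 1 else k - a)%N.
Proof.
have ltk := ltn_ord k; rewrite {2}near_hook_sum in ltk.
have l0 : nth 0%N lambda 0 = a by rewrite lambdaE.
have l1 : nth 0%N lambda 1 = 2%N by rewrite lambdaE.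
case: ifP => ka.
  have kE : nat_of_ord k = flatten_index lambda 0 k by rewrite /flatten_index take0.
  by rewrite kE flatten_indexKl ?l0.
case: ifP => ka2.
  have kE : nat_of_ord k = flatten_index lambda 1 (k - a).
    by rewrite /flatten_index lambdaE /=; lia.
  by rewrite kE flatten_indexKl ?l1 //; lia.
have kaE : (k - a = (k - a.+2).+2)%N by lia.
have lt_d : (k - a.+2 < d)%N by lia.
have kE : nat_of_ord k = flatten_index lambda (k - a) 0.
  rewrite /flatten_index lambdaE kaE /= take_cat size_nseq lt_d take_nseq ?(ltnW lt_d) //.
  by rewrite sumn_nseq; lia.
rewrite {1}kE flatten_indexKl // lambdaE kaE /= nth_cat size_nseq lt_d.
by rewrite nth_nseq lt_d.
Qed.

(** The disjunction allows d = 2 once the characteristic is known to be 2: this occurs for (a + 1,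
    2, 1^(d-1)) when d = 3. *)
Lemma hom_near_hook_two_row (f : {linear Weyl K lambda -> Weyl K mu}) :
    (exists v, f v != 0) -> (0 < d)%N -> (2%:R = 0 :> K) \/ (2 < d)%N ->
  2%:R = 0 :> K /\ a%:R = 0 :> K.
Proof.
move=> f_neq0 d_gt0 d_or; have a_gt1 := near_hook_a_gt1; have rE := near_hook_sum.
have [u u_sym /= []] := weyl_hom_coefficients f_neq0.
set L := row_word lambda => w_neq0 w_rel.
have box k : (k < a + d + 2)%N -> {P : 'I_r | nat_of_ord P = k}.
  by rewrite -rE => lt_k; exists (Ordinal lt_k).
(* o0, o1 are the first two boxes of row 0 of lambda, b1, b2 are row 1, and   *)
(* the boxes from a.+2 on are the d rows of length one; p2, p3 are row 1 of mu. *)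
have [//|o0 o0E] := box 0%N; first lia.
have [//|o1 o1E] := box 1%N; first lia.
have [//|b1 b1E] := box a; first lia.
have [//|b2 b2E] := box a.+1; first lia.
have [//|p2 p2E] := box (a + d)%N; first lia.
have [//|p3 p3E] := box (a + d).+1; first lia.
have m_gt1 : (1 < a + d)%N by lia.
have LE (k : 'I_r) : L k = (if k < a then 0 else if k < a.+2 then 1 else k - a)%N :> nat.
  by rewrite row_wordE near_hook_row.
have [psi [psiC psi0 psiE]] :=
  two_row_coefficients m_gt1 muE o0E o1E p2E p3E L (L o0) u_sym.
pose G (P Q : 'I_r) : K := psi (L P) (L Q).
have GC (P Q : 'I_r) : G P Q = G Q P by apply: psiC.
have LP0 (P : 'I_r) : (P < a)%N -> L P = L o0.
  by move=> ltP; apply: val_inj; rewrite /= !LE ltP o0E ltnW.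
have G0 (P Q : 'I_r) : (P < a)%N -> G P Q = 0 by move=> /LP0 E; rewrite /G E psi0.
(* The coefficient at any permutation sending o0, o1, p2, p3 to q0, q1, q2, q3. *)
pose F q0 q1 q2 q3 := G q2 q3 - G q0 q3 - G q2 q1 + G q0 q1.
have F_rel (q0 q1 q2 q3 Q0 : 'I_r) (j : 'I_n) : uniq [:: q0; q1; q2; q3] -> (j < L Q0)%N ->
    F q0 q1 q2 q3 + \sum_(Q | L Q == j) F (tperm Q0 Q q0) (tperm Q0 Q q1)
                                   (tperm Q0 Q q2) (tperm Q0 Q q3) = 0.
  move=> uq ltj.
  have [s] := @perm_extension _ [:: o0; o1; p2; p3] [:: q0; q1; q2; q3] erefl
    (two_row_corners m_gt1 o0E o1E p2E p3E) uq.
  case=> s0 s1 s2 s3.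
  have := w_rel s Q0 j ltj; rewrite psiE s0 s1 s2 s3 -/(F _ _ _ _) => {2}<-.
  congr (_ + _); apply: eq_bigr => Q _.
  by rewrite psiE !permM s0 s1 s2 s3.
have neq (P Q : 'I_r) : (P : nat) <> Q -> P != Q by move=> PQ; apply/eqP=> E; rewrite E in PQ.
have tn (P Q R : 'I_r) : (P : nat) <> R -> (Q : nat) <> R -> tperm P Q R = R.
  by move=> PR QR; rewrite tpermD ?neq.
have G0r (P Q : 'I_r) : (Q < a)%N -> G P Q = 0 by move=> ltQ; rewrite GC G0.
have [o0a o1a] : (o0 < a)%N /\ (o1 < a)%N by lia.
have F01 q2 q3 : F o0 o1 q2 q3 = G q2 q3.
  by rewrite /F (G0 o0 q3 o0a) (G0r q2 o1 o1a) (G0 o0 o1 o0a) !subr0 addr0.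
have F01t (Q0 Q q2 q3 : 'I_r) : (1 < Q0)%N -> (1 < Q)%N ->
    F (tperm Q0 Q o0) (tperm Q0 Q o1) q2 q3 = G q2 q3.
  by move=> Q01 Q1; rewrite !tn ?F01 //; lia.
have L1 (Q : 'I_r) : (L Q == L b1) = (Q == b1) || (Q == b2).
  rewrite -!val_eqE /= !LE b1E b2E.
  by do ?case: ifP => ?; lia.
have L2 (k Q : 'I_r) : (a.+2 <= k)%N -> (L Q == L k) = (Q == k).
  move=> lek; rewrite -!val_eqE /= !LE.
  by do ?case: ifP => ?; lia.
have Lb : L b2 = L b1 by apply/eqP; rewrite L1 eqxx orbT.
have Gb Q : G b2 Q = G b1 Q by rewrite /G Lb.
have sum1 (H : 'I_r -> K) : \sum_(Q | L Q == L b1) H Q = H b1 + H b2.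
  rewrite (bigD1 b1) ?eqxx //= (big_pred1 b2) // => Q.
  rewrite L1 /=; case: (eqVneq Q b1) => [->|]; rewrite ?andbT //=.
  by rewrite -val_eqE /=; lia.
have u4 (q2 q3 : 'I_r) : (1 < q2)%N -> (q2 < q3)%N -> uniq [:: o0; o1; q2; q3].
  by move=> *; rewrite /= !inE -!val_eqE /=; lia.
have Lb1 (k : 'I_r) : (a.+2 <= k)%N -> (L b1 < L k)%N.
  by move=> lek; rewrite !LE b1E; do ?case: ifP => ?; lia.
(* Raising k into row 1 gives G b1 b2 + G k b2 + G b1 k = 0, and b1, b2 carry the same letter. *)
have relA (k : 'I_r) : (a.+2 <= k)%N -> G b1 b2 = - (G b1 k *+ 2).
  move=> lek; have := F_rel o0 o1 b1 b2 k (L b1) (u4 b1 b2 _ _) (Lb1 k lek).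
  rewrite sum1 F01 !F01t ?tpermR ?tn; try lia.
  rewrite (GC k b2) Gb => /(_ _ _)/eqP; rewrite addr_eq0 mulr2n => E.
  by apply/eqP/E; lia.
have relC (k l : 'I_r) : (a.+2 <= k)%N -> (a.+2 <= l)%N -> k != l ->
    G k l = - (G b1 l *+ 2).
  move=> lek lel /eqP kl; have {}kl : (k : nat) <> l by move/val_inj.
  have := F_rel o0 o1 b1 l k (L b1) (u4 b1 l _ _) (Lb1 k lek).
  rewrite sum1 F01 !F01t ?tpermR ?tn; try lia.
  move=> /(_ _ _) E; apply/eqP; rewrite -addr_eq0 mulr2n addrCA.
  by rewrite E //; lia.
(* With d >= 3 there are two rows of length one other than that of l; exchanging their boxes leaves
   b1 and l in place, so the coefficient is just doubled. *)
have rel2 (l : 'I_r) : (2 < d)%N -> (a.+2 <= l)%N -> G b1 l *+ 2 = 0.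
  move=> d_gt2 lel.
  have [j [k [lej ltjk jl kl]]] : exists j k : 'I_r,
      [/\ (a.+2 <= j)%N, (j < k)%N, (j : nat) <> l & (k : nat) <> l].
    have [//|e0 E0] := box a.+2; first lia.
    have [//|e1 E1] := box a.+3; first lia.
    have [//|e2 E2] := box a.+4; first lia.
    have [El|nl0] := eqVneq (l : nat) a.+2; first by exists e1, e2; split; lia.
    have [El|nl1] := eqVneq (l : nat) a.+3; first by exists e0, e2; split; lia.
    by exists e0, e1; split; lia.
  have ltL : (L j < L k)%N by rewrite !LE; do ?case: ifP => ?; lia.
  have := F_rel o0 o1 b1 l k (L j) (u4 b1 l _ _) ltL.
  rewrite (big_pred1 j) => [|Q]; last by rewrite L2.
  rewrite F01 F01t ?tn; try lia.
  by rewrite mulr2n; apply; lia.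
(* Raise b2 into row 0. The exchange with o0 contributes 0, the one with o1 contributes G b1 l - G
   b1 b2, and each of the other a - 2 contributes G b1 l. *)
have rela (l : 'I_r) : (a.+2 <= l)%N -> G b1 l *+ a = G b1 b2.
  move=> lel.
  have ltL : (L o0 < L b2)%N by rewrite !LE o0E b2E; do ?case: ifP => ?; lia.
  have := F_rel o0 o1 b1 l b2 (L o0) (u4 b1 l _ _) ltL.
  have o1o0 : (L o1 == L o0) && (o1 != o0).
    by rewrite LP0 ?eqxx ?neq //; lia.
  rewrite (bigD1 o0) ?eqxx //= (bigD1 o1) //=.
  have Ea : \sum_(Q | L Q == L o0) G b1 l = G b1 l *+ a.
    rewrite (eq_bigl (fun Q : 'I_r => Q < a)%N) => [|Q].
      by rewrite -(big_ord_widen r (fun=> G b1 l)) ?sumr_const ?card_ord //; lia.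
    by rewrite -val_eqE /= !LE o0E; do ?case: ifP => ?; lia.
  rewrite (bigD1 o0) ?eqxx //= (bigD1 o1) //= in Ea.
  rewrite (eq_bigr (fun=> G b1 l)) => [|Q /andP[/andP[LQ Q0] Q1]]; last first.
    have ltQ : (Q < a)%N.
      by move: LQ; rewrite -val_eqE /= !LE o0E; do ?case: ifP => ?; lia.
    move: Q0 Q1; rewrite -!val_eqE /= o0E o1E => Q0 Q1.
    by rewrite !tn ?F01 //; lia.
  rewrite -Ea !tpermR !tn; try lia.
  have -> : F b2 o1 b1 l = 0 by rewrite /F Gb !(G0r _ o1) // subrr subr0 addr0.
  have -> : F o0 b2 b1 l = G b1 l - G b1 b2 by rewrite /F !(G0 o0) // subr0 addr0.
  set rest := \sum_(_ | _) _; rewrite F01 => /(_ _ _) E.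
  apply/eqP; rewrite -subr_eq0 -E; [apply/eqP; ring | lia | lia].
have Bd (l : 'I_r) : (a.+2 <= l)%N -> G b1 l *+ 2 = 0.
  by case: d_or => [two0 _|d_gt2 lel]; [rewrite -mulr_natl two0 mul0r | apply: rel2].
(* Otherwise [relA] and [relC] make G vanish on all pairs of distinct boxes, and every coefficient
   is 0. *)
have [l lel Gl] : exists2 l : 'I_r, (a.+2 <= l)%N & G b1 l != 0.
  apply/exists_inP; apply: contraT; rewrite negb_exists_in => /forall_inP B0.
  have {}B0 (l : 'I_r) : (a.+2 <= l)%N -> G b1 l = 0.
    by move=> /B0; rewrite negbK => /eqP.
  have A0 : G b1 b2 = 0.
    have [//|e0 E0] := box a.+2; first lia.
    by rewrite (relA e0) ?B0 ?mul0rn ?oppr0 //; lia.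
  have GPQ (P Q : 'I_r) : P != Q -> G P Q = 0.
    move=> PQ; have [ltP|leP] := ltnP P a; first exact: G0.
    have [ltQ|leQ] := ltnP Q a; first exact: G0r.
    have vE (R S : 'I_r) : (R : nat) = S -> R = S by apply: val_inj.
    have low (R S : 'I_r) : (a <= R < a.+2)%N -> (a <= S)%N -> R != S -> G R S = 0.
      move=> /andP[leR ltR] leS; rewrite -val_eqE /= => RS.
      have GRS : G R S = G b1 S.
        have [|] : R = b1 \/ R = b2.
          by have [E|E] := eqVneq (R : nat) a; [left|right]; apply: vE; lia.
          by move->.
        by move->.
      have [leS2|ltS2] := leqP a.+2 S; first by rewrite GRS B0.
      have [E|E] := eqVneq (R : nat) a.
        by rewrite GRS (vE S b2) //; lia.
      have -> : R = b2 by apply: vE; lia.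
      by have -> : S = b1 by [apply: vE; lia]; rewrite GC.
    have [ltP2|leP2] := ltnP P a.+2; first by apply: low => //; rewrite leP.
    have [ltQ2|leQ2] := ltnP Q a.+2; first by rewrite GC low // ?leQ // eq_sym.
    by rewrite relC // B0 // mul0rn oppr0.
  have [s] := w_neq0; rewrite psiE.
  have := two_row_corners m_gt1 o0E o1E p2E p3E.
  rewrite -(map_inj_uniq (@perm_inj _ s)) /= !inE !negb_or.
  case/and4P=> /and3P[s01 s02 s03] /andP[s12 s13] s23 _.
  have -> : psi (L (s p2)) (L (s p3)) = 0 by apply: GPQ.
  have -> : psi (L (s o0)) (L (s p3)) = 0 by apply: GPQ.
  have -> : psi (L (s p2)) (L (s o1)) = 0 by apply: GPQ; rewrite eq_sym.
  have -> : psi (L (s o0)) (L (s o1)) = 0 by apply: GPQ.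
  by rewrite !subr0 addr0 eqxx.
have two0 : 2%:R = 0 :> K.
  have /eqP := Bd l lel.
  by rewrite -[X in X == _ -> _]mulr_natl mulf_eq0 (negPf Gl) orbF => /eqP.
split=> //; have := rela l lel; rewrite (relA l lel) (Bd l lel) oppr0.
by move/eqP; rewrite -[X in X == _ -> _]mulr_natl mulf_eq0 (negPf Gl) orbF => /eqP.
Qed.

End NearHook.

(** * Carter-Payne pairs in characteristic 2 *)

Section CarterPaynePairs.

Variables n r : nat.

Lemma nth_pad s k : nth 0%N (pad n s) k = nth 0%N s k.
Proof.
rewrite nth_cat nth_nseq if_same; case: ltnP => // le_k.
by rewrite nth_default.
Qed.

Lemma Lambda_plus_pad_size (a : Lambda_plus n r) s :
  a = pad n s :> seq nat -> (size s <= n)%N.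
Proof.
by move/(congr1 size); rewrite size_tuple size_cat size_nseq; lia.
Qed.

Lemma Lambda_plus_eq_pad (a : Lambda_plus n r) s :
  (size s <= n)%N -> (forall k, nth 0%N a k = nth 0%N s k) ->
  a = pad n s :> seq nat.
Proof.
move=> le_s aE; apply: (@eq_from_nth _ 0%N) => [|k _]; last by rewrite nth_pad.
by rewrite size_tuple size_cat size_nseq; lia.
Qed.

(** Since e >= 1, the modulus is a positive power of 2; only its parity consequence is kept. *)
Lemma carter_payne_pair2 (a b : Lambda_plus n r) : carter_payne_pair 2 a b ->
  exists i j e, [/\ (i < j)%N, (0 < e)%N,
    nth 0 b i = (nth 0 a i + e)%N /\ nth 0 a j = (nth 0 b j + e)%N,
    forall q, q <> i -> q <> j -> nth 0 b q = nth 0%N a q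
    & ~~ odd ((nth 0 a i - nth 0 a j) + (j - i) + e)]%N.
Proof.
case=> i [j [e [ltij e_gt0]]]; rewrite !(tnth_nth 0%N) => bE bq div_p.
exists i, j, e; split=> // [q qi qj|].
  have [ltq|leq] := ltnP q n; last by rewrite !nth_default ?size_tuple.
  have := bq (Ordinal ltq); rewrite !(tnth_nth 0%N); apply.
    by rewrite -val_eqE; apply/eqP.
  by rewrite -val_eqE; apply/eqP.
rewrite -dvdn2; apply: dvdn_trans div_p.
by rewrite -{1}(expn1 2) dvdn_exp2l // up_log_gt0; lia.
Qed.

(** Boxes can leave only row 1 or the last row d + 1, one at a time. From the last row, the targets
    1 and 2 give the odd numbers d + 2 and d, and a lower target would not leave a partition. *)
Lemma carter_payne_pair_near_hook (a b : Lambda_plus n r) k d :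
    a = pad n [:: k, 2 & nseq d 1]%N :> seq nat ->
    (0 < d)%N -> odd d -> carter_payne_pair 2 a b ->
  b = pad n [:: k.+1, 2 & nseq d.-1 1]%N :> seq nat \/
  b = pad n (k.+1 :: nseq d.+1 1)%N :> seq nat.
Proof.
move=> aE d_gt0 d_odd /carter_payne_pair2[i [j [e [ltij e_gt0 [bi bj] bq par]]]].
have le_n := Lambda_plus_pad_size aE.
rewrite /= size_nseq in le_n.
have an q : nth 0%N a q = (if q == 0 then k else if q == 1 then 2 else
    if q < d.+2 then 1 else 0)%N.
  by rewrite aE nth_pad; case: q => [|[|q]] //=; rewrite nth_nseq.
have b_geq := Lambda_plus_nth_geq b.
rewrite !an in bi bj par.
have jd : (j < d.+2)%N by move: bj; case: ifP; [lia|case: ifP; [lia|case: ifP; lia]].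
have [j1|j1] := eqVneq j 1%N.
  have i0 : i = 0%N by lia.
  rewrite i0 j1 /= in bi bj bq par.
  right; apply: Lambda_plus_eq_pad => [|q]; first by rewrite /= size_nseq.
  (* Row 2 has length 1, so row 1 can lose only one box. *)
  have b12 := b_geq 1%N 2%N isT.
  rewrite (bq 2%N) // an [(2 < _)%N]d_gt0 /= in b12.
  case: q => [|[|q]]; rewrite /= ?nth_nseq; [lia | lia|].
  by rewrite bq // an.
have jE : j = d.+1.
  apply/eqP; apply: contraT => nj.
  have := b_geq j j.+1 (leqnSn j); rewrite (bq j.+1) ?an; try lia.
  by move: bj; do ?case: ifP => ?; lia.
have e1 : e = 1%N /\ nth 0%N b j = 0%N by move: bj; do ?case: ifP => ?; lia.
have [E|E] := eqVneq i 0%N.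
  left; apply: Lambda_plus_eq_pad => [|q]; first by rewrite /= size_nseq; lia.
  case: q => [|[|q]]; rewrite /= ?nth_nseq.
  - by rewrite E /= in bi; lia.
  - by rewrite bq ?an //; lia.
  have [qE|qE] := eqVneq q.+2 j; first by rewrite qE; case: ifP; lia.
  by rewrite bq ?an; try lia; do ?case: ifP => ?; lia.
have [E1|E1] := eqVneq i 1%N.
  by exfalso; move: par; rewrite E1 jE /=; do ?case: ifP => ?; lia.
have [E2|E2] := eqVneq i 2%N.
  by exfalso; move: par; rewrite E2 jE /=; do ?case: ifP => ?; lia.
exfalso; have := b_geq i.-1 i (leq_pred i); rewrite bi (bq i.-1) ?an; try lia.
by do ?case: ifP => ?; lia.
Qed.

(** Only the box of the last row can move. Raising it to row 0 gives the odd number k + d; raising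
    it to row 1 gives the even number d. *)
Lemma carter_payne_pair_hook (a b : Lambda_plus n r) k d :
    a = pad n (k :: nseq d 1)%N :> seq nat ->
    odd k -> ~~ odd d -> (0 < d)%N -> carter_payne_pair 2 a b ->
  b = pad n [:: k, 2 & nseq d.-2 1]%N :> seq nat.
Proof.
move=> aE k_odd d_even d_gt0 /carter_payne_pair2[i [j [e [ltij e_gt0 [bi bj] bq par]]]].
have le_n := Lambda_plus_pad_size aE.
rewrite /= size_nseq in le_n.
have an q : nth 0%N a q = (if q == 0 then k else if q < d.+1 then 1 else 0)%N.
  by rewrite aE nth_pad; case: q => [|q] //=; rewrite nth_nseq.
have b_geq := Lambda_plus_nth_geq b.
rewrite !an in bi bj par.
have jd : (j < d.+1)%N by move: bj; do ?case: ifP => ?; lia.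
have jE : j = d.
  apply/eqP; apply: contraT => nj.
  have := b_geq j j.+1 (leqnSn j); rewrite (bq j.+1) ?an; try lia.
  by move: bj; do ?case: ifP => ?; lia.
have e1 : e = 1%N /\ nth 0%N b j = 0%N by move: bj; do ?case: ifP => ?; lia.
have [E|E] := eqVneq i 0%N.
  by exfalso; move: par; rewrite E jE /=; do ?case: ifP => ?; lia.
have [E1|E1] := eqVneq i 1%N.
  apply: Lambda_plus_eq_pad => [|q]; first by rewrite /= size_nseq; lia.
  case: q => [|[|q]]; rewrite /= ?nth_nseq.
  - by rewrite bq ?an //; lia.
  - by rewrite E1 /= in bi; move: bi; do ?case: ifP => ?; lia.
  have [qE|qE] := eqVneq q.+2 j; first by rewrite qE; case: ifP; lia.
  by rewrite bq ?an; try lia; do ?case: ifP => ?; lia.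
exfalso; have := b_geq i.-1 i (leq_pred i); rewrite bi (bq i.-1) ?an; try lia.
by do ?case: ifP => ?; lia.
Qed.

End CarterPaynePairs.

Theorem mainTheorem3 (K : fieldType) (p n r a d : nat)
  (K_infinite : forall s : seq K, exists x : K, x \notin s)
  (K_char : p \in [pchar K])
  (r_gt0 : (0 < r)%N) (r_le_n : (r <= n)%N)
  (d_ge3 : (3 <= d)%N) (d_odd : odd d)
  (lambda mu : Lambda_plus n r)
  (lambdaE : lambda = pad n [:: a, 2 & nseq d 1]%N :> seq nat)
  (muE : mu = pad n [:: a + d; 2]%N :> seq nat)
  (h : {linear Weyl K lambda -> Weyl K mu}) :
  (exists v, h v != 0) -> ~ carter_payne_composition p h.
Proof.
move=> h_neq0 h_comp.
have [||two0 a0] := hom_near_hook_two_row lambdaE muE h_neq0; [lia | by right|].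
have p2 : p = 2%N.
  have : (p %| 2)%N by rewrite (dvdn_pcharf K_char) two0.
  by rewrite (dvdn_prime2 (pcharf_prime K_char)) // => /eqP.
rewrite p2 in K_char h_comp.
have a_even : ~~ odd a by rewrite -dvdn2 (dvdn_pcharf K_char) a0.
(* A nonzero map here would force a + 1 = 0 in K, whereas a = 0 already. *)
have tail_eq0 (c : Lambda_plus n r) (g : {linear Weyl K c -> Weyl K mu}) :
    c = pad n [:: a.+1, 2 & nseq d.-1 1]%N :> seq nat -> ~ (exists v, g v != 0).
  move=> cE g_neq0.
  have muE' : mu = pad n [:: a.+1 + d.-1; 2]%N :> seq nat.
    by rewrite muE; congr (pad n [:: _; 2%N]); lia.
  have [||_] := hom_near_hook_two_row cE muE' g_neq0; [lia | by left|].
  by move/eqP; rewrite -natr1 a0 add0r oner_eq0.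
have d_gt0 : (0 < d)%N by lia.
have mu1 : nth 0%N mu 1%N = 2%N by rewrite muE nth_pad.
have mu2 : nth 0%N mu 2%N = 0%N by rewrite muE nth_pad.
have comp_neq0 (b c : Lambda_plus n r) (h1 : {linear Weyl K b -> Weyl K mu})
    (f : {linear Weyl K b -> Weyl K c}) (g : {linear Weyl K c -> Weyl K mu}) :
    h1 =1 g \o f -> (exists v, h1 v != 0) -> exists v, g v != 0.
  by move=> E [v]; rewrite E; exists (f v).
(* A single step cannot end at mu: one candidate has third part 1 instead of 0, the other has second
   part 1 instead of 2. *)
case: h_comp => [[lambda_mu _]|c f g [lambda_c _] g_comp hE].
  by case: (carter_payne_pair_near_hook lambdaE d_gt0 d_odd lambda_mu) => E;
    move: mu1 mu2; rewrite E !nth_pad //= nth_nseq; case: ifP => //; lia.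
have g_neq0 := comp_neq0 _ _ _ _ _ hE h_neq0.
case: (carter_payne_pair_near_hook lambdaE d_gt0 d_odd lambda_c) => cE.
  exact: tail_eq0 cE g_neq0.
have a1_odd : odd a.+1 by [].
have d1_even : ~~ odd d.+1 by rewrite /= negbK.
case: g_comp => [[c_mu _]|c' f' g' [c_c' _] _ gE].
  have E := carter_payne_pair_hook cE a1_odd d1_even (ltn0Sn d) c_mu.
  by move: mu2; rewrite E !nth_pad //= nth_nseq; case: ifP => //; lia.
have c'E := carter_payne_pair_hook cE a1_odd d1_even (ltn0Sn d) c_c'.
exact: tail_eq0 c'E (comp_neq0 _ _ _ _ _ gE g_neq0).
Qed.
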